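(* Let $d$ and $r$ be integers with $1 \le r < \frac{d}{2}$, and let $\Delta$ be an $(r-1)$-stacked $\mathbf{k}$-homology $(d-1)$-manifold without boundary. Then (i) $\beta_k(\Delta) = 0$ for $r \le k \le d-1-r$; (ii) $\Delta$ has no missing $k$-faces with $r+1 \le k \le d-r$.
   Context: $\mathbf{k}$ is a fixed infinite field. For a finite simplicial complex $\Gamma$ on vertex set $V$, $\beta_i(\Gamma) = \dim_{\mathbf{k}} \tilde H_i(\Gamma;\mathbf{k})$, and for a face $F$, $\mathrm{lk}_\Gamma(F) = \{G \in \Gamma : F\cup G \in \Gamma,\ F \cap G = \emptyset\}$. A face (or subset) $F$ has dimension $\#F-1$. A missing $k$-face of $\Gamma$ is a subset of $V$ of cardinality $k+1$ that is not a face but all of whose proper subsets are faces. A complex $\Gamma$ of dimension $m$ is a $\mathbf{k}$-homology $m$-sphere if for every face $F$ (including $\emptyset$), $\beta_i(\mathrm{lk}_\Gamma F)=0$ for $i \ne m-\#F$ and $\beta_{m-\#F}(\mathrm{lk}_\Gamma F)=1$. A homology $m$-manifold without boundary is a pure $m$-dimensional complex all of whose vertex links are homology $(m-1)$-spheres. A pure $m$-dimensional complex $\Gamma$ is a homology $m$-manifold with boundary if (i) for every nonempty face $F$, $\beta_i(\mathrm{lk}_\Gamma F) = 0$ for $i \neq m-\#F$ and $\beta_{m-\#F}(\mathrm{lk}_\Gamma F) \in \{0,1\}$; (ii) the boundary $\partial\Gamma = \{F \in \Gamma : \beta_i(\mathrm{lk}_\Gamma F)=0 \text{ for all } i\}\cup\{\emptyset\}$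 is a homology $(m-1)$-manifold without boundary. Faces not in $\partial\Gamma$ are interior faces. A homology $m$-manifold with boundary is $s$-stacked if it has no interior faces of dimension $\le m-s-1$; a homology manifold without boundary is $s$-stacked if it equals $\partial\Sigma$ for some $s$-stacked homology manifold with boundary $\Sigma$. *)

(* Defs.v *)
From HB Require Import structures.
From mathcomp Require Import all_boot all_order all_algebra.

Set Implicit Arguments.
Unset Strict Implicit.
Unset Printing Implicit Defensive.

Import Order.TTheory GRing.Theory Num.Theory.
Local Open Scope ring_scope.

Definition infinite_carrier (T : eqType) : Prop :=
  forall s : seq T, exists x : T, x \notin s.

(* A simplicial complex is a set of faces over an ambient finite type V;
   elements of V need not be vertices, so that links and boundaries live over
   the same V.  Dimensions are integers since the empty face has dimension -1. *)
Section Complexes.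
Variable V : finType.
Implicit Types (Gam : {set {set V}}) (F G : {set V}) (v : V) (i m : int).

Definition fdim F : int := #|F|%:Z - 1.

Definition simplicial_complex Gam : Prop :=
  set0 \in Gam /\ (forall F G, F \in Gam -> G \subset F -> G \in Gam).

Definition link Gam F : {set {set V}} :=
  [set G in Gam | (F :|: G \in Gam) && [disjoint F & G]].

Definition dimension Gam m : Prop :=
  (forall F, F \in Gam -> fdim F <= m) /\
  (exists F, F \in Gam /\ fdim F = m).

Definition facet Gam F : bool := maxset [pred G | G \in Gam] F.

Definition pure Gam m : Prop :=
  dimension Gam m /\ (forall F, facet Gam F -> fdim F = m).

Definition missing_face Gam (i : int) F : Prop :=
  [/\ fdim F = i, F \notin Gam & forall G, G \proper F -> G \in Gam].

End Complexes.

(* Reduced simplicial homology.  Chains of all degrees of the full simplex on V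
   are functions {set V} -> k; the empty face is a generator in degree -1.
   The signs come from the total order on V given by enum_rank. *)
Section Homology.
Variables (k : fieldType) (V : finType).
Implicit Types (Gam : {set {set V}}) (F G : {set V}) (v : V) (i m : int).

Definition chain : vectType k := {ffun {set V} -> k^o}.

Definition elem_chain F : chain := [ffun G => (G == F)%:R].

Definition face_sign F v : k :=
  (-1) ^+ #|[set u in F | (enum_rank u < enum_rank v)%N]|.

Definition face_boundary F : chain :=
  \sum_(v in F) face_sign F v *: elem_chain (F :\ v).

Definition boundary_fun (c : chain) : chain :=
  \sum_F (c : {ffun {set V} -> k^o}) F *: face_boundary F.

Fact boundary_fun_is_linear : linear boundary_fun.
Proof.
move=> a b c; rewrite /boundary_fun scaler_sumr -big_split /=.
by apply: eq_bigr => F _; rewrite !ffunE scalerDl scalerA.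
Qed.

HB.instance Definition _ :=
  GRing.isLinear.Build k chain chain *:%R boundary_fun boundary_fun_is_linear.

Definition boundary_map : 'End(chain) := linfun boundary_fun.

Definition chains Gam i : {vspace chain} :=
  <<[seq elem_chain F | F <- enum Gam & fdim F == i]>>%VS.

Definition cycles Gam i : {vspace chain} :=
  (chains Gam i :&: lker boundary_map)%VS.

Definition boundaries Gam i : {vspace chain} :=
  (boundary_map @: chains Gam (i + 1))%VS.

(* The truncated subtraction is the dimension of the quotient, see
   boundaries_sub_cycles below. *)
Definition betti Gam i : nat := (\dim (cycles Gam i) - \dim (boundaries Gam i))%N.

Lemma boundary_elem F : boundary_map (elem_chain F) = face_boundary F.
Proof.
rewrite lfunE /= /boundary_fun (bigD1 F) //= ffunE eqxx scale1r big1 ?addr0 //.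
by move=> G /negPf nGF; rewrite ffunE nGF scale0r.
Qed.

Lemma face_sign_lt F v w : (enum_rank w < enum_rank v)%N ->
  face_sign (F :\ v) w = face_sign F w.
Proof.
move=> lt_wv; rewrite /face_sign; congr (_ ^+ #|pred_of_set _|).
apply/setP=> u; rewrite !inE; case: eqP => //= ->.
by rewrite ltnNge (ltnW lt_wv) andbF.
Qed.

Lemma face_sign_gt F v w : v \in F -> (enum_rank v < enum_rank w)%N ->
  face_sign (F :\ v) w = - face_sign F w.
Proof.
move=> vF lt_vw; rewrite /face_sign.
set A := [set u in F | _]; set B := [set u in _ | _].
have -> : B = A :\ v by apply/setP=> u; rewrite !inE andbA.
by rewrite (cardsD1 v A) inE vF lt_vw exprS mulN1r opprK.
Qed.

Lemma boundary_boundary F : boundary_map (face_boundary F) = 0.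
Proof.
rewrite linear_sum /=.
pose t v w := (face_sign F v * face_sign (F :\ v) w) *: elem_chain (F :\ v :\ w).
transitivity (\sum_(v in F) \sum_(w in F | w != v) t v w).
  apply: eq_bigr => v vF; rewrite linearZ /= boundary_elem scaler_sumr.
  by apply: eq_big => [w | w _]; rewrite ?inE 1?andbC ?scalerA.
transitivity (\sum_(v in F) \sum_(w in F | (enum_rank w < enum_rank v)%N) t v w +
              \sum_(v in F) \sum_(w in F | (enum_rank v < enum_rank w)%N) t v w).
  rewrite -big_split; apply: eq_bigr => v _ /=.
  rewrite (bigID (fun w => (enum_rank w < enum_rank v)%N)) /=; congr (_ + _).
    apply: eq_bigl => w; rewrite -andbA; congr (_ && _).
    by case: eqP => [->|//]; rewrite ltnn.
  apply: eq_bigl => w; rewrite -andbA; congr (_ && _).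
  rewrite -leqNgt [RHS]ltn_neqAle eq_sym.
  by rewrite (inj_eq val_inj) (inj_eq enum_rank_inj).
rewrite (exchange_big_dep (fun v => v \in F)) /=; last by move=> ? ? _ /andP[].
rewrite -big_split big1 //= => v vF.
rewrite (eq_bigl (fun w => (w \in F) && (enum_rank v < enum_rank w)%N)); last first.
  by move=> w; rewrite vF.
rewrite -big_split big1 //= => w /andP[wF lt_vw]; rewrite /t.
rewrite face_sign_lt // (face_sign_gt vF lt_vw) mulrN scaleNr [F :\ w :\ v]setDDl.
by rewrite setUC -setDDl [face_sign F w * _]mulrC subrr.
Qed.

Lemma boundaries_sub_cycles Gam i :
  simplicial_complex Gam -> (boundaries Gam i <= cycles Gam i)%VS.
Proof.
move=> [_ downGam]; rewrite /boundaries limg_span; apply/span_subvP => c.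
case/mapP=> b /mapP[F]; rewrite mem_filter mem_enum => /andP[/eqP dimF FGam] -> ->.
rewrite boundary_elem memv_cap memv_ker boundary_boundary eqxx andbT.
apply: memv_suml => v vF; apply/memvZ/memv_span/map_f.
rewrite mem_filter mem_enum (downGam F) ?subD1set // andbT.
by move: dimF; rewrite /fdim (cardsD1 v F) vF PoszD addrAC subrr add0r => ->; rewrite addrK.
Qed.

Lemma betti_out Gam i : (forall F, F \in Gam -> fdim F != i) -> betti Gam i = 0%N.
Proof.
move=> dimGam; apply/eqP; rewrite subn_eq0 (@leq_trans 0) //.
rewrite leqn0 dimv_eq0 -subv0 (subv_trans (capvSl _ _)) //.
apply/span_subvP=> c /mapP[F]; rewrite mem_filter mem_enum => /andP[dimF FGam].
by rewrite (negPf (dimGam F FGam)) in dimF.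
Qed.

(* All Betti numbers outside the degrees -1, ..., #|V| - 1 vanish. *)
Definition acyclic Gam : bool :=
  [forall j : 'I_(#|V|.+1), betti Gam ((j : nat)%:Z - 1) == 0%N].

Lemma acyclicP Gam : reflect (forall i, betti Gam i = 0%N) (acyclic Gam).
Proof.
apply: (iffP forallP) => [acyc i | acyc j]; last exact/eqP.
have [[j def_i] | out_i] := altP (@existsP _ (fun j : 'I_#|V|.+1 => i == (j : nat)%:Z - 1)).
  by rewrite (eqP def_i); apply/eqP.
apply: betti_out => F _; apply: contra out_i => /eqP <-; apply/existsP.
by exists (inord #|F|); rewrite inordK // ltnS max_card.
Qed.

End Homology.

Section Manifolds.
Variable k : fieldType.

Definition homology_sphere (V : finType) (m : int) (Gam : {set {set V}}) : Prop :=
  [/\ simplicial_complex Gam, dimension Gam m &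
      forall F, F \in Gam ->
        (forall i : int, i != m - #|F|%:Z -> betti k (link Gam F) i = 0%N) /\
        betti k (link Gam F) (m - #|F|%:Z) = 1%N].

Definition homology_manifold (V : finType) (m : int) (Gam : {set {set V}}) : Prop :=
  [/\ simplicial_complex Gam, pure Gam m &
      forall v : V, [set v] \in Gam ->
        homology_sphere (m - 1) (link Gam [set v])].

Definition bdry (V : finType) (Gam : {set {set V}}) : {set {set V}} :=
  [set F in Gam | acyclic k (link Gam F)] :|: [set set0].

Definition homology_manifold_with_bdry
    (V : finType) (m : int) (Gam : {set {set V}}) : Prop :=
  [/\ simplicial_complex Gam,
      pure Gam m,
      (forall F, F \in Gam -> F != set0 ->
        (forall i : int, i != m - #|F|%:Z -> betti k (link Gam F) i = 0%N) /\
        (betti k (link Gam F) (m - #|F|%:Z) = 0%N \/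
         betti k (link Gam F) (m - #|F|%:Z) = 1%N)) &
      homology_manifold (m - 1) (bdry Gam)].

Definition interior_face (V : finType) (Gam : {set {set V}}) (F : {set V}) : bool :=
  (F \in Gam) && (F \notin bdry Gam).

Definition stacked_with_bdry
    (V : finType) (s m : int) (Gam : {set {set V}}) : Prop :=
  homology_manifold_with_bdry m Gam /\
  (forall F, interior_face Gam F -> ~ (fdim F <= m - s - 1)).

(* The filling Sig may use vertices outside V: its faces live over V + U for an
   arbitrary finite type U of additional vertices.  Its dimension can only be
   m + 1, since bdry Sig is pure of dimension one less than Sig. *)
Definition stacked (V : finType) (s m : int) (Gam : {set {set V}}) : Prop :=
  homology_manifold m Gam /\
  exists (U : finType) (Sig : {set {set (V + U)%type}}),
    stacked_with_bdry s (m + 1) Sig /\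
    bdry Sig = [set [set inl v | v in F] | F : {set V} in Gam].

End Manifolds.

(* Main.v *)
Require Import Defs.
From mathcomp Require Import all_boot all_order all_algebra.
From mathcomp Require Import zify.

Set Implicit Arguments.
Unset Strict Implicit.
Unset Printing Implicit Defensive.

Import Order.TTheory GRing.Theory Num.Theory.
Local Open Scope ring_scope.

(* Let Sig be an (r-1)-stacked filling of Delta.  The link of a nonempty face of
   Sig has no homology in degrees >= r - 1: it is acyclic if the face is on the
   boundary, and has dimension at most r - 2 otherwise.  By the exact sequence of
   a vertex deletion, starting from the full vertex set, this persists for every
   induced subcomplex of such a link.  Adding the vertices of W one at a time,
   the same sequence shows that the subcomplex of Sig induced on any set W of
   vertices has no homology in degrees >= r.  Since Delta and Sig have the same
   faces up to dimension d - r, taking W to be all vertices gives (i).  A missing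
   k-face F of Delta in the given range is missing in Sig too, so taking W = F
   yields the boundary of a k-simplex, whose (k-1)-st homology is nonzero: a
   contradiction, which gives (ii). *)

(** * Chains and the boundary map in coordinates *)

Section Chains.
Variables (k : fieldType) (V : finType).
Implicit Types (K : {set {set V}}) (F G W : {set V}) (u v : V) (i j : int).
Implicit Types (c w : chain k V).

Definition coef c F : k := (c : {ffun {set V} -> k^o}) F.

Lemma chain_ext c w : (forall F, coef c F = coef w F) -> c = w.
Proof. by move=> eq_cw; apply/ffunP. Qed.

Lemma coef0 F : coef 0 F = 0. Proof. exact: ffunE. Qed.
Lemma coefD c w F : coef (c + w) F = coef c F + coef w F.
Proof. exact: ffunE. Qed.
Lemma coefB c w F : coef (c - w) F = coef c F - coef w F.
Proof. by rewrite /coef !ffunE. Qed.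
Lemma coefZ (a : k) c F : coef (a *: c) F = a * coef c F.
Proof. exact: ffunE. Qed.
Lemma coef_elem F G : coef (elem_chain k F) G = (G == F)%:R.
Proof. exact: ffunE. Qed.
Lemma coef_sum (I : Type) (s : seq I) (P : pred I) (h : I -> chain k V) F :
  coef (\sum_(x <- s | P x) h x) F = \sum_(x <- s | P x) coef (h x) F.
Proof. exact: (big_morph (fun c => coef c F) (fun c w => coefD c w F) (coef0 F)). Qed.

Lemma chain_sum_elem c : c = \sum_F coef c F *: elem_chain k F.
Proof.
apply: chain_ext => F; rewrite coef_sum (bigD1 F) //= coefZ coef_elem eqxx mulr1.
by rewrite big1 ?addr0 // => G nGF; rewrite coefZ coef_elem eq_sym (negPf nGF) mulr0.
Qed.

Lemma chainsP K i c :
  reflect (forall F, coef c F != 0 -> F \in K /\ fdim F = i) (c \in chains k K i).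
Proof.
apply: (iffP idP) => [cK F | supp_c].
  suff imp : ~~ ((F \in K) && (fdim F == i)) -> coef c F == 0.
    by move/(contraNT imp)/andP=> [KF /eqP].
  move=> notKF; apply/eqP.
  pose s := in_tuple [seq elem_chain k G | G <- enum K & fdim G == i].
  have cs : c \in <<s>>%VS by [].
  rewrite (coord_span cs) coef_sum big1 // => j _; rewrite coefZ.
  have: s`_j \in s by rewrite mem_nth.
  case/mapP=> G; rewrite mem_filter mem_enum => /andP[/eqP dimG KG] ->.
  by rewrite coef_elem; case: eqP => [eqFG | _]; rewrite ?mulr0 //; rewrite eqFG KG dimG eqxx in notKF.
rewrite [c]chain_sum_elem; apply: memv_suml => F _.
have [-> | nz] := eqVneq (coef c F) 0; first by rewrite scale0r mem0v.
have [KF dimF] := supp_c F nz; apply/memvZ/memv_span/map_f.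
by rewrite mem_filter mem_enum KF dimF eqxx.
Qed.

Lemma face_signU1 F v : face_sign k (v |: F) v = face_sign k F v.
Proof.
rewrite /face_sign; congr (_ ^+ #|pred_of_set _|).
by apply/setP=> u; rewrite !inE; case: eqP => // ->; rewrite ltnn !andbF.
Qed.

Lemma face_sign_sqr F v : face_sign k F v * face_sign k F v = 1.
Proof. by rewrite /face_sign -expr2 sqrr_sign. Qed.

(** Inserting the smaller of u, v flips the sign of the larger, while inserting the larger leaves
    the sign of the smaller alone; so exactly one factor changes. *)
Lemma face_sign_swap F u v : u \notin F -> v \notin F -> u != v ->
  face_sign k (v |: F) u * face_sign k (u |: F) v =
  - (face_sign k F u * face_sign k F v).
Proof.
wlog lt_uv : u v / (enum_rank u < enum_rank v)%N => [IH uF vF nuv | uF vF nuv].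
  case: (ltngtP (enum_rank u) (enum_rank v)) => [lt | lt | eq_r]; first exact: IH.
    by rewrite mulrC IH 1?eq_sym // mulrC.
  by case/eqP: nuv; apply/enum_rank_inj/val_inj.
have := @face_sign_lt k V (v |: F) v u lt_uv; rewrite setU1K // => <-.
have := @face_sign_gt k V (u |: F) u v (setU11 _ _) lt_uv; rewrite setU1K // => ->.
by rewrite mulrN opprK.
Qed.

(** Exchanging the sums over faces and their vertices leaves, for each v outside F, only the coface
    [v |: F]. Identities between chains then become pointwise computations. *)
Lemma coef_boundary c F :
  coef (boundary_map k V c) F = \sum_(v | v \notin F) face_sign k F v * coef c (v |: F).
Proof.
rewrite lfunE /= /boundary_fun coef_sum.
transitivity (\sum_(G : {set V}) \sum_(v in G | F == G :\ v) coef c G * face_sign k G v).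
  apply: eq_bigr => G _; rewrite coefZ coef_sum big_distrr big_mkcondr /=.
  apply: eq_bigr => v _; rewrite coefZ coef_elem.
  by case: eqP; rewrite ?mulr1 ?mulr0.
rewrite (exchange_big_dep predT) //= [RHS]big_mkcond; apply: eq_bigr => v _.
case: ifPn => [vF | /negPn vF].
  rewrite (big_pred1 (v |: F)) => [|G]; first by rewrite face_signU1 mulrC.
  apply/andP/eqP => [[vG /eqP ->] | ->]; first by rewrite setD1K.
  by rewrite setU11 setU1K.
by apply: big_pred0 => G; apply/andP=> -[_ /eqP eqF]; rewrite eqF !inE eqxx in vF.
Qed.

Lemma boundary_map2 c : boundary_map k V (boundary_map k V c) = 0.
Proof.
rewrite [c]chain_sum_elem !linear_sum big1 // => F _.
by rewrite !linearZ /= boundary_elem boundary_boundary scaler0.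
Qed.

(** * Cones over a vertex and contraction at it *)

Definition avoids v c := forall F, v \in F -> coef c F = 0.

(** The sign makes this the join with v oriented as if v came first, so that [boundary_cone] carries
    no degree-dependent sign. *)
Definition cone v c : chain k V :=
  [ffun F : {set V} => if v \in F then face_sign k F v * coef c (F :\ v) else 0 : k^o].

(** The signs are those of [cone], so that [cone v (contract v c)] is exactly the part of c on faces
    through v. *)
Definition contract v c : chain k V :=
  [ffun F : {set V} => if v \in F then 0 else face_sign k F v * coef c (v |: F) : k^o].

Lemma coef_cone v c F :
  coef (cone v c) F = if v \in F then face_sign k F v * coef c (F :\ v) else 0.
Proof. exact: ffunE. Qed.

Lemma coef_contract v c F :
  coef (contract v c) F = if v \in F then 0 else face_sign k F v * coef c (v |: F).
Proof. exact: ffunE. Qed.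

Lemma avoids_boundary v c : avoids v c -> avoids v (boundary_map k V c).
Proof.
move=> cv F vF; rewrite coef_boundary big1 // => u _.
by rewrite cv ?mulr0 // inE vF orbT.
Qed.

Lemma avoids_cone v c : avoids v (cone v c) -> avoids v c -> c = 0.
Proof.
move=> conev cv; apply: chain_ext => F; rewrite coef0.
have [vF | vF] := boolP (v \in F); first exact: cv.
have := conev (v |: F) (setU11 v F); rewrite coef_cone setU11 setU1K // => eq0.
by rewrite -[LHS]mul1r -(face_sign_sqr (v |: F) v) -mulrA eq0 mulr0.
Qed.

Lemma avoids_contract v c : avoids v (contract v c).
Proof. by move=> F vF; rewrite coef_contract vF. Qed.

Lemma avoids_sub_cone v c : avoids v (c - cone v (contract v c)).
Proof.
move=> F vF; rewrite coefB coef_cone vF coef_contract !inE eqxx /=.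
rewrite setD1K // -{2}(setD1K vF) face_signU1 mulrA face_sign_sqr mul1r.
by rewrite subrr.
Qed.

Lemma avoidsD v c w : avoids v c -> avoids v w -> avoids v (c + w).
Proof. by move=> cv wv F vF; rewrite coefD cv ?wv ?addr0. Qed.

Lemma avoidsB v c w : avoids v c -> avoids v w -> avoids v (c - w).
Proof. by move=> cv wv F vF; rewrite coefB cv ?wv ?subr0. Qed.

Lemma boundary_cone v c : avoids v c ->
  boundary_map k V (cone v c) = c - cone v (boundary_map k V c).
Proof.
move=> cv; apply: chain_ext => F; rewrite coefB coef_cone coef_boundary.
have [vF | vF] := boolP (v \in F); last first.
  rewrite subr0 (bigD1 v) //= coef_cone setU11 setU1K // face_signU1.
  rewrite mulrA face_sign_sqr mul1r big1 ?addr0 // => u /andP[_ nuv].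
  by rewrite coef_cone !inE eq_sym (negPf nuv) (negPf vF) mulr0.
(* At a face F through v, the term of index v on the right is the coefficient of c at F, which is
   zero; the remaining terms match up to sign by [face_sign_swap]. *)
rewrite cv // sub0r coef_boundary [in RHS](bigD1 v) /= ?inE ?eqxx //.
rewrite setD1K // cv // mulr0 add0r mulr_sumr -sumrN; apply: eq_big => u.
  rewrite !inE negb_and negbK; case: eqP => [-> | _]; rewrite ?vF ?andbT //.
move=> uF; have nuv : u != v by apply: contraNneq uF => ->.
rewrite coef_cone !inE vF orbT.
have -> : (u |: F) :\ v = u |: F :\ v.
  by apply/setP=> x; rewrite !inE; case: eqP => // ->; rewrite eq_sym (negPf nuv).
have uFv : u \notin F :\ v by rewrite !inE (negPf uF) andbF.
have vFv : v \notin F :\ v by rewrite !inE eqxx.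
rewrite -[F in u |: F](setD1K vF) setUCA face_signU1 !mulrA.
rewrite -{1}(setD1K vF) face_sign_swap // mulNr.
by rewrite -[in RHS](setD1K vF) face_signU1 setU1K // [face_sign _ _ u * _]mulrC.
Qed.

(** * Vanishing homology, and deletion or addition of a vertex *)

Definition vanish K i : bool := (cycles k K i <= boundaries k K i)%VS.

Definition restrict K W : {set {set V}} := [set F in K | F \subset W].

Lemma cyclesP K i c :
  reflect (c \in chains k K i /\ boundary_map k V c = 0) (c \in cycles k K i).
Proof. by rewrite memv_cap memv_ker; apply: (iffP andP) => -[? /eqP]. Qed.

Lemma vanishP K i :
  reflect (forall z, z \in chains k K i -> boundary_map k V z = 0 ->
             exists2 y, y \in chains k K (i + 1) & boundary_map k V y = z)
          (vanish K i).
Proof.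
apply: (iffP subvP) => [van z zK dz | van z /cyclesP[zK /(van z zK)[y yK <-]]].
  by have /memv_imgP[y yK ->] := van z (introT (cyclesP _ _ _) (conj zK dz)); exists y.
exact: memv_img.
Qed.

Lemma vanish_betti K i : vanish K i -> betti k K i = 0%N.
Proof. by move=> van; apply/eqP; rewrite subn_eq0 dimvS. Qed.

(** As [betti] is a truncated difference, its vanishing only bounds the dimension of the cycles by
    that of the boundaries. The inclusion of boundaries in cycles turns this into equality. *)
Lemma betti_vanish K i : simplicial_complex K -> betti k K i = 0%N -> vanish K i.
Proof.
move=> cxK /eqP; rewrite subn_eq0 /vanish => dim_le.
have sBZ := boundaries_sub_cycles k i cxK.
suff /eqP-> : boundaries k K i == cycles k K i by [].
by rewrite -(dimv_leqif_eq sBZ) eqn_leq dim_le dimvS.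
Qed.

Lemma vanish_out K i : (forall F, F \in K -> fdim F != i) -> vanish K i.
Proof.
move=> outK; apply/vanishP => z /chainsP zK _; exists 0; rewrite ?mem0v ?linear0 //.
apply: chain_ext => F; rewrite coef0; apply/esym/eqP/contraT => /zK[/outK].
by move=> /eqP.
Qed.

Lemma fdimU1 v F : v \notin F -> fdim (v |: F) = fdim F + 1.
Proof. by rewrite /fdim cardsU1 => ->; lia. Qed.

Lemma fdimD1 v F : v \in F -> fdim (F :\ v) = fdim F - 1.
Proof. by rewrite /fdim (cardsD1 v F) => ->; lia. Qed.

(* A chain whose boundary avoids v can be pushed off v: its link at v is a cycle
   of the link, and coning a filling of that cycle gives the correction. *)
Lemma avoids_boundary_modify K i v w : simplicial_complex K ->
    vanish (link K [set v]) (i - 1) -> w \in chains k K i ->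
    avoids v (boundary_map k V w) ->
  exists2 y, y \in chains k K (i + 1) &
    w + boundary_map k V y \in chains k (restrict K (~: [set v])) i.
Proof.
move=> [_ downK] /vanishP van_lk /chainsP wK dwv.
set a := contract v w; set b := w - cone v a.
have av : avoids v a by exact: avoids_contract.
have bv : avoids v b by exact: avoids_sub_cone.
have [] := van_lk a.
- apply/chainsP=> F; rewrite coef_contract; case: ifPn => [|vF]; rewrite ?eqxx //.
  rewrite mulf_eq0 negb_or => /andP[_ /wK[KvF dimvF]].
  split; last by move: dimvF; rewrite fdimU1 //; lia.
  by rewrite inE KvF (downK _ _ KvF (subsetUr _ _)) disjoints1.
(* To see that a is a cycle, take the boundary of w = b + [cone v a]: it expresses the cone over the
   boundary of a through chains avoiding v, and a cone avoiding v is zero. *)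
- apply: (@avoids_cone v); last exact: avoids_boundary.
  have -> : cone v (boundary_map k V a) =
      a + boundary_map k V b - boundary_map k V w.
    rewrite linearB /= (boundary_cone av).
    by rewrite opprB addrCA addrAC subrr add0r addrCA subrr addr0.
  by apply: avoidsB => //; apply: avoidsD => //; apply: avoids_boundary.
rewrite subrK => c /chainsP c_lk dc.
have cv : avoids v c.
  move=> F vF; apply/eqP; apply: contraT => /c_lk[].
  by rewrite inE disjoints1 vF !andbF.
(* Since c has boundary a, its cone has boundary c - [cone v a]; adding this to w cancels the part
   through v and leaves b + c. *)
exists (cone v c).
  apply/chainsP=> F; rewrite coef_cone; case: ifPn => [vF|]; rewrite ?eqxx //.
  rewrite mulf_eq0 negb_or => /andP[_ /c_lk[]]; rewrite inE setD1K // fdimD1 //.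
  by case/and3P=> _ -> _ dimF; split=> //; lia.
have -> : w + boundary_map k V (cone v c) = b + c.
  by rewrite boundary_cone // dc [w + _]addrA [w + c]addrC -addrA addrC.
apply/chainsP=> F nz.
have vF : v \notin F by apply: contra_neqN nz => vF; rewrite coefD bv ?cv ?addr0.
suff [KF ->] : F \in K /\ fdim F = i by rewrite inE KF subsetC sub1set inE.
have [c0 | /c_lk[]] := eqVneq (coef c F) 0; last by rewrite inE => /and3P[].
by apply: wK; move: nz; rewrite coefD c0 coefB coef_cone (negPf vF) subr0 addr0.
Qed.

Lemma chains_restrict K W i c : c \in chains k (restrict K W) i -> c \in chains k K i.
Proof. by move/chainsP=> cK; apply/chainsP=> F /cK[]; rewrite inE => /andP[]. Qed.

(** Exactness at the homology of K between deletion and link: a cycle is pushed off v, then filled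
    in the deletion. *)
Lemma vanish_add_vertex K i v : simplicial_complex K ->
  vanish (restrict K (~: [set v])) i -> vanish (link K [set v]) (i - 1) ->
  vanish K i.
Proof.
move=> cxK /vanishP van_del van_lk; apply/vanishP=> z zK dz.
have [|y yK] := avoids_boundary_modify cxK van_lk zK; first by rewrite dz => F _; rewrite coef0.
case/van_del => [|x xK dx]; first by rewrite linearD /= dz add0r boundary_map2.
exists (x - y); last by rewrite linearB /= dx addrK.
by rewrite rpredB // (chains_restrict xK).
Qed.

(** Exactness at the homology of the deletion: a cycle there is filled by some w in K, and w is
    pushed off v. As w has degree i + 1, the link is needed in degree i. *)
Lemma vanish_delete_vertex K i v : simplicial_complex K ->
  vanish K i -> vanish (link K [set v]) i ->
  vanish (restrict K (~: [set v])) i.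
Proof.
move=> cxK /vanishP van_K van_lk; apply/vanishP=> z zK dz.
have [w wK dw] := van_K z (chains_restrict zK) dz.
have [| | y yK wy] := @avoids_boundary_modify K (i + 1) v w cxK _ wK.
- by rewrite addrK.
- rewrite dw => F vF; apply/eqP; apply: contraT => /(chainsP _ _ _ zK)[].
  by rewrite inE subsetC sub1set inE vF andbF.
by exists (w + boundary_map k V y); rewrite // linearD /= dw boundary_map2 addr0.
Qed.

End Chains.

(** * Induced subcomplexes and their links *)

Section Restriction.
Variables (k : fieldType) (V : finType).
Implicit Types (K : {set {set V}}) (F G W : {set V}) (v : V) (i : int).

Lemma restrict_complex K W : simplicial_complex K -> simplicial_complex (restrict K W).
Proof.
case=> K0 downK; split=> [|F G]; first by rewrite inE K0 sub0set.
rewrite !inE => /andP[KF FW] GF; rewrite (subset_trans GF FW) andbT.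
exact: downK GF.
Qed.

Lemma link_complex K F : simplicial_complex K -> F \in K -> simplicial_complex (link K F).
Proof.
case=> K0 downK KF; split=> [|G H]; first by rewrite inE K0 setU0 KF -setI_eq0 setI0 eqxx.
rewrite !inE => /and3P[KG KFG dFG] HG; rewrite (downK _ _ KG HG).
by rewrite (downK _ _ KFG (setUS _ HG)) (disjointWr HG dFG).
Qed.

(** Lets later statements range over all nonempty sets F: the link of a nonface lacks even the empty
    face, and [vanish] holds for it in every degree. *)
Lemma link_out K F : simplicial_complex K -> F \notin K -> link K F = set0.
Proof.
case=> _ downK KF; apply/setP=> G; rewrite !inE; apply: contraNF KF.
by case/and3P=> _ KFG _; apply: downK KFG (subsetUl _ _).
Qed.

Lemma restrictT K : restrict K setT = K.
Proof. by apply/setP=> F; rewrite inE subsetT andbT. Qed.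

Lemma restrict_delete K W v :
  restrict (restrict K W) (~: [set v]) = restrict K (W :\ v).
Proof.
apply/setP=> F; rewrite !inE -andbA subsetD1; do 2 congr (_ && _).
by rewrite subsetC sub1set inE.
Qed.

Lemma link_restrict K W v : v \in W ->
  link (restrict K W) [set v] = restrict (link K [set v]) W.
Proof.
move=> vW; apply/setP=> F; rewrite !inE subUset sub1set vW /=.
by case: (F \in K); case: (F \subset W); rewrite ?andbF ?andbT.
Qed.

Lemma link_link K F v : simplicial_complex K ->
  link (link K F) [set v] = if v \in F then set0 else link K (v |: F).
Proof.
case=> _ downK; apply/setP=> G; rewrite !inE !disjoints1.
have eqU : F :|: (v |: G) = v |: F :|: G by rewrite setUCA setUA.
have disj1 H : (H :&: [set v] == set0) = (v \notin H) by rewrite setIC setI_eq0 disjoints1.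
rewrite eqU -!setI_eq0 setIUr setU_eq0 disj1.
case: ifPn => vF; first by rewrite inE !andbF.
rewrite !inE -setI_eq0 setIUl setU_eq0 [[set v] :&: G]setIC disj1.
have [KvFG | _] := boolP (v |: F :|: G \in K); last by rewrite !andbF.
rewrite (downK _ _ KvFG (_ : F :|: G \subset _)) -?setUA ?subsetUr //.
rewrite (downK _ _ KvFG (_ : v |: G \subset _)) /=.
  by case: (G \in K); case: (_ == _); case: (v \in G).
by rewrite setSU ?subsetUl.
Qed.

Lemma vanish_set0 i : vanish k (set0 : {set {set V}}) i.
Proof. by apply: vanish_out => F; rewrite inE. Qed.

Lemma restrict0 W : restrict set0 W = set0 :> {set {set V}}.
Proof. by apply/setP=> F; rewrite !inE. Qed.

(* Induction on the complement of W: the link of a deleted vertex in a restricted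
   link is again the restricted link of a nonempty face. *)
Lemma vanish_link_restrict K i0 : simplicial_complex K ->
    (forall F i, F != set0 -> i0 <= i -> vanish k (link K F) i) ->
  forall F W i, F != set0 -> i0 <= i -> vanish k (restrict (link K F) W) i.
Proof.
move=> cxK van_lk F W; move: {2}#|~: W| (erefl #|~: W|) => n.
elim: n => [|n IHn] in F W * => [/cards0_eq CW0 | cardW] i F0 le_i.
  by rewrite -[W]setCK CW0 setC0 restrictT van_lk.
have [KF | /link_out->//] := boolP (F \in K); last by rewrite restrict0 vanish_set0.
have /card_gt0P[v] : (0 < #|~: W|)%N by rewrite cardW.
rewrite inE => vW; set W' := v |: W.
have cardW' : #|~: W'| = n.
  by apply/eqP; rewrite -eqSS -cardW (cardsD1 v (~: W)) inE vW setCU setIC setDE.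
have -> : restrict (link K F) W = restrict (restrict (link K F) W') (~: [set v]).
  by rewrite restrict_delete setU1K.
apply: vanish_delete_vertex; first exact/restrict_complex/link_complex.
  exact: IHn.
rewrite link_restrict ?setU11 // link_link //; case: ifP => _.
  by rewrite restrict0 vanish_set0.
by apply: IHn => //; apply/set0Pn; exists v; rewrite setU11.
Qed.

(** Induction on the size of W. Adding v to W uses the restricted link of v in degree i - 1, whence
    the strict bound on i. For empty W only the face of dimension -1 can remain. *)
Lemma vanish_restrict K i0 : simplicial_complex K -> 0 <= i0 ->
    (forall F i, F != set0 -> i0 <= i -> vanish k (link K F) i) ->
  forall W i, i0 < i -> vanish k (restrict K W) i.
Proof.
move=> cxK i0_ge0 van_lk W; move: {2}#|W| (erefl #|W|) => n.
elim: n => [|n IHn] in W * => [/cards0_eq-> | cardW] i lt_i.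
  apply: vanish_out => F; rewrite inE subset0 => /andP[_ /eqP->].
  by rewrite /fdim cards0; lia.
have /card_gt0P[v vW] : (0 < #|W|)%N by rewrite cardW.
apply: (vanish_add_vertex (restrict_complex W cxK) (v := v)).
  rewrite restrict_delete; apply: IHn lt_i.
  by apply/eqP; rewrite -eqSS -cardW (cardsD1 v W) vW.
rewrite link_restrict //; apply: (vanish_link_restrict cxK van_lk); last by lia.
by apply/set0Pn; exists v; rewrite inE.
Qed.

End Restriction.

(** * Stacked manifolds, skeleta and missing faces *)

Section Manifold.
Variables (k : fieldType) (V : finType).
Implicit Types (Sig : {set {set V}}) (F G W : {set V}) (v : V) (s i m : int).

Lemma stacked_low_face s m Sig F : stacked_with_bdry k s m Sig ->
  F \in Sig -> fdim F <= m - s - 1 -> F \in bdry k Sig.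
Proof.
case=> _ no_int SigF le_dim; apply: contraT => notbd.
by case: (no_int F); rewrite // /interior_face SigF.
Qed.

Lemma stacked_vanish_link s m Sig : stacked_with_bdry k s m Sig ->
  forall F i, F != set0 -> s <= i -> vanish k (link Sig F) i.
Proof.
move=> stk F i F0 le_i; have [[cxS [[dim_le _] _] _ _] _] := stk.
have [SF | /link_out->//] := boolP (F \in Sig); last exact: vanish_set0.
have [low | high] := boolP (fdim F <= m - s - 1).
  have := stacked_low_face stk SF low; rewrite !inE SF (negPf F0) orbF /= => /acyclicP acyc.
  exact/betti_vanish/acyc/link_complex.
(* Here F has at least m - s + 1 vertices and its union with G at most m + 1, so G has dimension at
   most s - 1, below i. *)
apply: vanish_out => G; rewrite inE => /and3P[_ SFG disj].
move: (dim_le _ SFG) high; rewrite /fdim cardsU (eqP (_ : F :&: G == set0)) ?setI_eq0 //.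
by rewrite cards0; lia.
Qed.

Lemma stacked_vanish_restrict s m Sig : 0 <= s -> stacked_with_bdry k s m Sig ->
  forall W i, s < i -> vanish k (restrict Sig W) i.
Proof.
move=> s_ge0 stk; have [[cxS _ _ _] _] := stk.
exact: (vanish_restrict cxS s_ge0 (stacked_vanish_link stk)).
Qed.

Lemma vanish_eq_skeleton (K L : {set {set V}}) i :
  (forall F, fdim F <= i + 1 -> (F \in K) = (F \in L)) ->
  vanish k K i = vanish k L i.
Proof.
move=> eqKL; suff eq_ch j : j <= i + 1 -> chains k K j = chains k L j.
  by rewrite /vanish /cycles /boundaries !eq_ch //; lia.
move=> le_j; apply/vspaceP=> c; apply/chainsP/chainsP=> cK F /cK[KF dimF]; split=> //.
  by rewrite -eqKL ?dimF.
by rewrite eqKL ?dimF.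
Qed.

(** The boundary of the simplex F is a cycle of the induced subcomplex. Only F itself could have
    dimension i there, and it is absent, so a filling would be zero. *)
Lemma missing_face_not_vanish Sig F i : set0 \in Sig ->
  0 <= i -> missing_face Sig i F -> ~~ vanish k (restrict Sig F) (i - 1).
Proof.
move=> S0 i_ge0 [dimF SF propF]; apply/negP=> /vanishP/(_ (face_boundary k F)) [||y].
- apply/chainsP=> G; rewrite /face_boundary coef_sum => nz.
  have [v vF] : exists2 v, v \in F & G == F :\ v.
    apply/exists_inP; apply: contraNT nz; rewrite negb_exists_in => /forall_inP nG.
    rewrite big1 // => v vF; rewrite coefZ coef_elem.
    by rewrite (negPf (nG v vF)) mulr0.
  move/eqP->; rewrite inE subD1set propF ?properD1 //; split=> //.
  by rewrite fdimD1 // dimF.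
- exact: boundary_boundary.
rewrite subrK => /chainsP yS; have -> : y = 0.
  apply: chain_ext => G; rewrite coef0; apply/eqP; apply: contraT => /yS[].
  rewrite inE => /andP[SG GF] dimG; case/negP: SF.
  suff <- : G = F by [].
  apply/eqP; rewrite eqEcard GF /=; move: dimF dimG; rewrite /fdim; lia.
rewrite linear0 => /esym dF0.
have /card_gt0P[v vF] : (0 < #|F|)%N by move: dimF; rewrite /fdim; lia.
(* The boundary of F is nonzero: its coefficient at F minus v is a single sign. *)
have /eqP := congr1 (fun c => coef c (F :\ v)) dF0.
rewrite coef0 -boundary_elem coef_boundary (bigD1 v) ?inE ?eqxx //=.
rewrite coef_elem setD1K // eqxx mulr1 big1 ?addr0 ?signr_eq0 // => u /andP[_ nuv].
rewrite coef_elem; case: eqP => [/setP/(_ v) | _]; last exact: mulr0.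
by rewrite !inE eqxx vF eq_sym (negPf nuv).
Qed.

End Manifold.

(** * Transport of chains along an injection preserving the vertex order *)

Section Embedding.
Variables (k : fieldType) (V T : finType) (f : V -> T).
Hypothesis f_inj : injective f.
Hypothesis f_mono : forall u v,
  (enum_rank (f u) < enum_rank (f v))%N = (enum_rank u < enum_rank v)%N.
Implicit Types (K : {set {set V}}) (F : {set V}) (G : {set T}) (i : int).

Definition image_complex K : {set {set T}} := [set f @: F | F : {set V} in K].

Definition pull (c : chain k T) : chain k V := [ffun F : {set V} => coef c (f @: F) : k^o].

Definition push (c : chain k V) : chain k T :=
  [ffun G : {set T} => if G \subset f @: setT then coef c (f @^-1: G) else 0 : k^o].

Lemma coef_pull c F : coef (pull c) F = coef c (f @: F).
Proof. exact: ffunE. Qed.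

Lemma coef_push c G :
  coef (push c) G = if G \subset f @: setT then coef c (f @^-1: G) else 0.
Proof. exact: ffunE. Qed.

Lemma preim_imset F : f @^-1: (f @: F) = F.
Proof. by apply/setP=> u; rewrite inE mem_imset. Qed.

Lemma imset_subT F : f @: F \subset f @: setT.
Proof. by rewrite imsetS ?subsetT. Qed.

Lemma imset_preim G : G \subset f @: setT -> f @: (f @^-1: G) = G.
Proof.
move=> /subsetP Gf; apply/setP=> x; apply/imsetP/idP => [[u] | Gx].
  by rewrite inE => ? ->.
by have /imsetP[u _ def_x] := Gf x Gx; exists u; rewrite // inE -def_x.
Qed.

Lemma imset_fdim F : fdim (f @: F) = fdim F.
Proof. by rewrite /fdim card_imset. Qed.

Lemma mem_image_complex K F : (f @: F \in image_complex K) = (F \in K).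
Proof. by rewrite mem_imset //; apply: imset_inj. Qed.

Lemma face_sign_imset F v : face_sign k (f @: F) (f v) = face_sign k F v.
Proof.
rewrite /face_sign; congr (_ ^+ _); rewrite -(card_imset _ f_inj).
apply: eq_card => x; rewrite inE; apply/andP/imsetP => [[/imsetP[u Fu ->]] | [u]].
  by rewrite f_mono => lt_uv; exists u; rewrite // inE Fu.
by rewrite inE => /andP[Fu lt_uv] ->; rewrite f_mono mem_imset.
Qed.

Lemma pushK c : pull (push c) = c.
Proof. by apply: chain_ext => F; rewrite coef_pull coef_push imset_subT preim_imset. Qed.

(** The support condition is what makes pulling back commute with the boundary: [pull] forgets faces
    with vertices outside the image of f, yet these could contribute to the boundary on faces inside
    it. *)
Lemma pull_boundary c : (forall G, ~~ (G \subset f @: setT) -> coef c G = 0) ->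
  pull (boundary_map k T c) = boundary_map k V (pull c).
Proof.
move=> c_supp; apply: chain_ext => F; rewrite coef_pull !coef_boundary.
rewrite (bigID (mem (f @: setT))) /= addrC big1 => [|x /andP[_ fx]]; last first.
  by rewrite c_supp ?mulr0 // subUset sub1set (negPf fx).
rewrite add0r (eq_bigl (mem (f @: ~: F))) => [|x]; last first.
  apply/andP/imsetP => [[fFx /imsetP[u _ def_x]] | [u uF ->]].
    by exists u; rewrite // inE; apply: contra fFx => Fu; rewrite def_x mem_imset.
  by rewrite !mem_imset // inE; move: uF; rewrite inE.
rewrite big_imset /= => [|? ? _ _]; last exact: f_inj.
apply: eq_big => u; first by rewrite inE.
by rewrite coef_pull imsetU1 face_sign_imset.
Qed.

Lemma chains_push K i c : c \in chains k K i -> push c \in chains k (image_complex K) i.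
Proof.
move/chainsP=> cK; apply/chainsP=> G; rewrite coef_push.
case: ifP => [Gf /cK[KG dimG]|]; last by rewrite eqxx.
by rewrite -(imset_preim Gf) mem_image_complex imset_fdim.
Qed.

Lemma chains_pull K i c : c \in chains k (image_complex K) i -> pull c \in chains k K i.
Proof.
move/chainsP=> cK; apply/chainsP=> F; rewrite coef_pull => /cK[].
by rewrite mem_image_complex imset_fdim.
Qed.

Lemma push_supp c G : ~~ (G \subset f @: setT) -> coef (push c) G = 0.
Proof. by rewrite coef_push => /negPf->. Qed.

Lemma push_boundary c : boundary_map k T (push c) = push (boundary_map k V c).
Proof.
apply: chain_ext => G; rewrite coef_push; case: ifPn => [Gf | Gf].
  by rewrite -{1}(imset_preim Gf) -coef_pull pull_boundary ?pushK //; apply: push_supp.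
rewrite coef_boundary big1 // => x _; rewrite push_supp ?mulr0 //.
by apply: contra Gf; apply: subset_trans (subsetUr _ _).
Qed.

Lemma vanish_image_complex K i : vanish k (image_complex K) i -> vanish k K i.
Proof.
move/vanishP=> van; apply/vanishP=> z /chains_push zK dz.
have [|y yK dy] := van _ zK.
  by rewrite push_boundary dz; apply: chain_ext => G; rewrite coef_push !coef0 if_same.
exists (pull y); first exact: chains_pull.
rewrite -pull_boundary ?dy ?pushK // => G nGf; apply: contraNeq nGf.
by move=> /(chainsP _ _ _ yK)[/imsetP[F _ ->] _]; rewrite imset_subT.
Qed.

Lemma missing_face_imset K F i : missing_face K i F ->
  missing_face (image_complex K) i (f @: F).
Proof.
case=> dimF KF propF; split=> [||G]; rewrite ?imset_fdim ?mem_image_complex //.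
case/properP=> GF [x xF xG]; have Gf := subset_trans GF (imset_subT F).
rewrite -(imset_preim Gf) mem_image_complex propF //; apply/properP; split.
  by rewrite -(preim_imset F) preimsetS.
by case/imsetP: xF xG => u uF -> fuG; exists u; rewrite // inE.
Qed.

End Embedding.

(** The enumeration of a sum type lists the left summand first. Hence [inl] preserves the vertex
    order, and with it the signs. *)
Lemma enum_rank_inl (V U : finType) (v : V) :
  enum_rank (inl v : V + U) = enum_rank v :> nat.
Proof.
have rankE (S : finType) (x : S) : enum_rank x = index x (enum S) :> nat.
  by rewrite -{2}(nth_enum_rank x x) index_uniq ?enum_uniq // -cardE.
rewrite !rankE !enumT [in LHS]unlock index_cat map_f -?enumT ?mem_enum //.
by rewrite index_map // => ? ? [].
Qed.

Theorem theorem4p4 (k : fieldType) (k_infinite : infinite_carrier k)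
    (d r : int) (r_ge1 : 1 <= r) (r_lt : r%:~R < d%:~R / 2 :> rat)
    (V : finType) (Delta : {set {set V}})
    (Delta_stacked : stacked k (r - 1) (d - 1) Delta) :
  (forall i : int, r <= i <= d - 1 - r -> betti k Delta i = 0%N) /\
  (forall (i : int) (F : {set V}),
     r + 1 <= i <= d - r -> ~ missing_face Delta i F).
Proof.
have [_ [U [Sig [stk bdS]]]] := Delta_stacked.
pose f : V -> V + U := inl.
have f_inj : injective f by move=> ? ? [].
have f_mono u v : (enum_rank (f u) < enum_rank (f v))%N = (enum_rank u < enum_rank v)%N.
  by rewrite !enum_rank_inl.
have {}bdS : bdry k Sig = image_complex f Delta by [].
have [[[S0 _] _ _ _] _] := stk.
have r1_ge0 : 0 <= r - 1 by lia.
have vanS := stacked_vanish_restrict r1_ge0 stk.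
have bdS_sub F : F \in image_complex f Delta -> F \in Sig.
  by rewrite -bdS !inE => /orP[/andP[] | /eqP->].
(* For a filling of dimension m = d with s = r - 1, the bound m - s - 1 is d - r. *)
have bdS_low F : fdim F <= d - r -> (F \in image_complex f Delta) = (F \in Sig).
  move=> low; apply/idP/idP => [/bdS_sub // | SF]; rewrite -bdS.
  by apply: (stacked_low_face stk SF); apply: (le_trans low); lia.
split=> [i /andP[r_le le_i] | i F /andP[r_le le_i] missF].
  apply/vanish_betti/(vanish_image_complex f_inj f_mono).
  (* Homology in degree i involves faces up to dimension i + 1, which is at most d - r. *)
  rewrite (@vanish_eq_skeleton k _ _ Sig) => [|F dimF]; last first.
    by apply: bdS_low; apply: (le_trans dimF); lia.
  by rewrite -(restrictT Sig) vanS //; lia.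
have [dimF DF propF] := missing_face_imset f_inj missF.
have /negP[] : ~~ vanish k (restrict Sig (f @: F)) (i - 1).
  apply: missing_face_not_vanish => //; first by lia.
  (* That the image of F is not a face carries over to [Sig] because its dimension i is at most d -
     r. *)
  by split=> // [|G /propF/bdS_sub //]; rewrite -bdS_low // dimF; lia.
by apply: vanS; lia.
Qed.
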